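(* Let $G_1$ and $G_2$ be graphs on $n$ vertices with respective maximum degrees $\Delta_1$ and $\Delta_2$, where $\Delta_2 \ge 1$, and let $\Delta^\wedge_1$ be the maximum codegree of $G_1$. Let $t\ge 2$ be an integer, let $$\gamma=\frac{\Delta_2}{\Delta_2+1}\cdot\frac{t-1}{t},\qquad \alpha^*=\alpha^*(t,\Delta_2)= \frac{1}{2}\left(2+ \gamma + \sqrt{4\gamma + \gamma^2}\right),$$ and let $\alpha > \alpha^*$ and $0 < \epsilon <1/2$ be reals. If $\Delta^\wedge_1<t$ and $n$ is larger than each of the following four quantities: \begin{align*} &\left(t+\frac{\alpha (\alpha-1)}{(\alpha-1)^2-\alpha} \right) \Delta_2 + \Delta_1 \Delta_2,\\ &(2\alpha t+2) \Delta_2 + ((2\alpha+1)t-1) \Delta_2^2 + (1-\epsilon) \Delta_1\Delta_2,\\ &1 + \left( 2+ \frac{\epsilon}{1-2\epsilon}\right) \Delta_2 + \Delta_1 \Delta_2,\\ &\left( t + \frac{3 - \epsilon}{2} \right) \Delta_2 + \frac{3-\epsilon}{2} (t-1) \Delta_2^2 + \frac{1+ \epsilon}{2} \Delta_1\Delta_2, \end{align*} then $G_1$ and $G_2$ pack.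
   Context: All graphs are finite, without loops or multiple edges. Two graphs $G_1,G_2$ on $n$ vertices pack if there exist injective maps of their vertex sets into $[n]=\{1,\dots,n\}$ such that the images of their edge sets are disjoint (equivalently, $G_1$ is isomorphic to a subgraph of the complement of $G_2$). The maximum codegree $\Delta^\wedge(G)$ of a graph $G$ is the maximum, over all pairs of distinct vertices, of the number of common neighbours of the pair; thus $\Delta^\wedge(G)<t$ iff $G$ contains no copy of the complete bipartite graph $K_{2,t}$.
   Formalization: The value α = (3+√5)/2, for which the denominator (α−1)²−α in the first of the four quantities is zero and that quantity is undefined, is excluded; everything else is as stated. *)

(* Defs.v *)
From HB Require Import structures.
From mathcomp Require Import all_boot all_order all_algebra.
From mathcomp Require Import reals.

Set Implicit Arguments.
Unset Strict Implicit.
Unset Printing Implicit Defensive.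

Import Order.TTheory GRing.Theory Num.Theory.

Record sgraph (V : finType) := SGraph {
  adj :> rel V;
  adj_sym : symmetric adj;
  adj_irrefl : irreflexive adj
}.

Definition edges (V : finType) (G : sgraph V) : {set {set V}} :=
  [set [set p.1; p.2] | p in [set p : V * V | G p.1 p.2]].

Definition nbhd (V : finType) (G : sgraph V) (x : V) : {set V} :=
  [set y | G x y].

Definition max_degree (V : finType) (G : sgraph V) : nat :=
  \max_(x : V) #|nbhd G x|.

Definition max_codegree (V : finType) (G : sgraph V) : nat :=
  \max_(p : V * V | p.1 != p.2) #|nbhd G p.1 :&: nbhd G p.2|.

Definition edge_image (V W : finType) (f : V -> W) (G : sgraph V) :
  {set {set W}} := [set f @: e | e : {set V} in edges G].

Definition pack (n : nat) (V1 V2 : finType)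
    (G1 : sgraph V1) (G2 : sgraph V2) : Prop :=
  exists (f1 : V1 -> 'I_n) (f2 : V2 -> 'I_n),
    [/\ injective f1, injective f2
      & [disjoint edge_image f1 G1 & edge_image f2 G2]].

Local Open Scope ring_scope.

Definition pack_gamma (R : realType) (t D2 : nat) : R :=
  D2%:R / (D2%:R + 1) * ((t%:R - 1) / t%:R).

Definition alpha_star (R : realType) (t D2 : nat) : R :=
  let g := pack_gamma R t D2 in
  1 / 2 * (2 + g + Num.sqrt (4 * g + g ^+ 2)).

(* Main.v *)
(** Take a counterexample with as few edges in G1 ("blue") as possible, G2 being
    "red", and let u be a vertex of least positive blue degree d, with a blue edge
    uv.  By minimality both graphs can be placed on one vertex set so that uv is
    the only common edge.  Exchanging the blue roles of u and w never resolves the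
    conflict, so every w other than v is reached from u by a blue-red or a
    red-blue path, whence n - 1 <= 2 D1 D2.  Counting blue paths of length two from
    a vertex of maximum blue degree then gives d <= 2 (t - 1) D2 + 1, as G1 has no
    K_{2,t}.

    Hence the set S of vertices not reached from u by a blue-red path is large.
    Rotating the blue roles u -> s -> y -> u, with s in S and y not reached from u
    by a red-blue path, does not resolve the conflict either, so almost all of S is
    reached by red-blue paths both from u and from y.  As blue codegrees are small,
    the red neighbourhoods of u and y share more than D2 / 2 vertices, and
    there are more than 2 D2 such y: too many for the maximum red degree D2. *)

Require Import Defs.
From mathcomp Require Import all_boot all_order all_algebra.
From mathcomp Require Import reals.
From mathcomp Require Import perm zify lra.
Import Order.TTheory GRing.Theory Num.Theory.

Set Implicit Arguments.
Unset Strict Implicit.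
Unset Printing Implicit Defensive.

Local Open Scope nat_scope.

Lemma card_bigcup_leq (T I : finType) (A : {set I}) (F : I -> {set T}) (k : nat) :
  (forall i, i \in A -> #|F i| <= k) ->
  #|\bigcup_(i in A) F i| <= #|A| * k.
Proof.
move=> Fk; rewrite -sum_nat_const.
elim/big_rec2: _ => [|i m B Ai leBm]; first by rewrite cards0.
by rewrite (leq_trans (leq_card_setU _ _)) // leq_add ?Fk.
Qed.

(** * Two graphs on one vertex set with a single conflict, and the counting it allows *)

Section Conflicts.
Variable V : finType.
Implicit Types (B R G : sgraph V) (u v w s y : V).

Definition nbhd2 B R u : {set V} := \bigcup_(x in nbhd B u) nbhd R x.

Lemma nbhd2P B R u w :
  reflect (exists2 x, B u x & R x w) (w \in nbhd2 B R u).
Proof.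
apply: (iffP bigcupP) => [[x]|[x Bux Rxw]]; first by rewrite !inE; exists x.
by exists x; rewrite !inE.
Qed.

Lemma card_nbhd2 B R u q :
  (forall x, #|nbhd R x| <= q) -> #|nbhd2 B R u| <= #|nbhd B u| * q.
Proof. by move=> Rq; apply: card_bigcup_leq. Qed.

Definition self_packs B R : bool :=
  [exists p : {perm V}, [forall x, forall y, B x y ==> ~~ R (p x) (p y)]].

Definition near_packing B R u v : Prop :=
  [/\ B u v, R u v & forall x y, B x y -> R x y -> [set x; y] = [set u; v]].

Lemma self_packsI B R (p : {perm V}) :
  (forall x y, B x y -> R (p x) (p y) -> False) -> self_packs B R.
Proof.
move=> pP; apply/existsP; exists p; apply/forallP=> x; apply/forallP=> y.
by apply/implyP=> Bxy; apply/negP => /(pP _ _ Bxy).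
Qed.

Lemma near_packing_moved B R u v x y :
  near_packing B R u v -> x != u -> y != u -> B x y -> R x y -> False.
Proof.
move=> [_ _ cuv] xu yu Bxy /(cuv _ _ Bxy) /setP/(_ u).
by rewrite !inE eqxx eq_sym (negPf xu) eq_sym (negPf yu).
Qed.

(** The transposition of [u] and [w] must create a conflict at some blue edge [u r] or [w r], and
    [r] is then the middle of a two-step path from [u] to [w]. For [w = u] the path through [v]
    serves. *)
Lemma swap_blocked B R u v w :
  near_packing B R u v -> ~~ self_packs B R -> w != v ->
  w \in nbhd2 B R u :|: nbhd2 R B u.
Proof.
move=> near nopack wv; have [Buv Ruv cuv] := near.
have [->|wu] := eqVneq w u.
  by rewrite inE; apply/orP; left; apply/nbhd2P; exists v => //; rewrite adj_sym.
apply: contraNT nopack; rewrite inE negb_or => /andP[/nbhd2P nBR /nbhd2P nRB].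
have H1 r : B u r -> R w r -> False.
  by move=> Bur Rrw; apply: nBR; exists r => //; rewrite adj_sym.
have H2 r : B w r -> R u r -> False.
  by move=> Bur Rrw; apply: nRB; exists r => //; rewrite adj_sym.
have H3 : B u w -> R u w -> False.
  move=> Buw /(cuv _ _ Buw) /setP/(_ w).
  by rewrite !inE eqxx (negPf wu) (negPf wv).
apply: (@self_packsI _ _ (tperm u w)) => x y.
case: tpermP => [->|->|/eqP xu /eqP xw]; case: tpermP => [->|->|/eqP yu /eqP yw];
  rewrite ?adj_irrefl //.
- by rewrite (adj_sym R).
- exact: H1.
- by rewrite (adj_sym B).
- exact: H2.
- by rewrite (adj_sym B) (adj_sym R); apply: H1.
- by rewrite (adj_sym B) (adj_sym R); apply: H2.
- exact: near_packing_moved near xu yu.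
Qed.

(** Rotate the blue roles [u -> s -> y -> u]. A conflict from a blue edge leaving the triple at [u]
    or [y] is excluded by the choice of [s] or [y]; one at [s] gives a red-blue path from [y] to
    [s]. The terms [nbhd B y] and [nbhd R y], with [s \notin nbhd R u], take care of edges inside
    the triple. *)
Lemma rotation_blocked B R u v s y :
  near_packing B R u v -> ~~ self_packs B R ->
  s \notin nbhd2 B R u -> s \notin nbhd R u ->
  y \notin nbhd2 R B u -> y != v ->
  s \in nbhd2 R B y :|: nbhd B y :|: nbhd R y.
Proof.
move=> near nopack sBR sR yRB yv; have [Buv Ruv cuv] := near.
have su : s != u.
  by apply: contraNneq sBR => ->; apply/nbhd2P; exists v => //; rewrite adj_sym.
have yu : y != u.
  by apply: contraNneq yRB => ->; apply/nbhd2P; exists v => //; rewrite adj_sym.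
have sy : s != y.
  apply: contraTneq (swap_blocked near nopack yv) => sy.
  by rewrite inE negb_or -{1}sy sBR.
apply: contraNT nopack; rewrite !inE !negb_or => /andP[/andP[/nbhd2P nsy nBys] nRys].
have H1 r : B u r -> R s r -> False.
  by move=> Bur Rrw; move/nbhd2P: sBR; apply; exists r => //; rewrite adj_sym.
have H2 r : B s r -> R y r -> False.
  by move=> Bur Rrw; apply: nsy; exists r => //; rewrite adj_sym.
have H3 r : B y r -> R u r -> False.
  by move=> Bur Rrw; move/nbhd2P: yRB; apply; exists r => //; rewrite adj_sym.
have H4 : ~~ R u s by rewrite inE in sR.
pose p : {perm V} := (tperm u s * tperm u y)%g.
have pu : p u = s by rewrite permM tpermL tpermD // eq_sym.
have ps : p s = y by rewrite permM tpermR tpermL.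
have py : p y = u by rewrite permM (tpermD (z := y)) ?tpermR // eq_sym.
have pD r : r != u -> r != s -> r != y -> p r = r.
  by move=> ru rs ry; rewrite permM !tpermD // eq_sym.
have nRsy : ~~ R s y by rewrite adj_sym.
have nBsy : ~~ B s y by rewrite adj_sym.
have nRsu : ~~ R s u by rewrite adj_sym.
apply: (@self_packsI _ _ p) => a c.
have [->|au] := eqVneq a u; [rewrite pu | have [->|a_s] := eqVneq a s;
  [rewrite ps | have [->|ay] := eqVneq a y; [rewrite py | rewrite (pD a) //]]];
(have [->|cu] := eqVneq c u; [rewrite pu | have [->|c_s] := eqVneq c s;
  [rewrite ps | have [->|cy] := eqVneq c y; [rewrite py | rewrite (pD c) //]]]);
rewrite ?adj_irrefl //.
all: rewrite ?(negPf nRsy) ?(negPf nRys) ?(negPf nBys) ?(negPf nBsy) ?(negPf H4) ?(negPf nRsu) //.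
all: try by [apply: H1 | apply: H2 | apply: H3 | exact: near_packing_moved near au cu].
(* The mirror cases, where the moved endpoint is the second one. *)
all: rewrite (adj_sym B) (adj_sym R).
all: by [apply: H1 | apply: H2 | apply: H3].
Qed.

(** A shared vertex either has one neighbour in both [P] and [Q], or is a common neighbour of two
    distinct centres, of which each pair has at most [k]. *)
Lemma card_common_nbhd2 B (P Q : {set V}) (D k : nat) :
  (forall x, #|nbhd B x| <= D) ->
  (forall x y, x != y -> #|nbhd B x :&: nbhd B y| <= k) ->
  #|(\bigcup_(x in P) nbhd B x) :&: (\bigcup_(x in Q) nbhd B x)|
    <= #|P :&: Q| * D + #|P| * #|Q| * k.
Proof.
move=> BD Bk; set A := _ :&: \bigcup_(x in Q) _.
pose M := \bigcup_(p in setX P Q) if p.1 == p.2 then set0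
                                  else nbhd B p.1 :&: nbhd B p.2.
have sub : A \subset (\bigcup_(x in P :&: Q) nbhd B x) :|: M.
  apply/subsetP=> z; rewrite !inE => /andP[/bigcupP[x Px zx] /bigcupP[y Qy zy]].
  have [xy|xy] := eqVneq x y.
    by apply/orP; left; apply/bigcupP; exists x => //; rewrite inE Px xy.
  apply/orP; right; apply/bigcupP; exists (x, y) => /=; first by rewrite in_setX Px.
  by rewrite (negPf xy) inE zx.
apply: leq_trans (subset_leq_card sub) _.
apply: leq_trans (leq_card_setU _ _) (leq_add _ _).
  exact: card_bigcup_leq.
rewrite -cardsX; apply: card_bigcup_leq => -[x y] _ /=.
by case: eqVneq => [_|/Bk //]; rewrite cards0.
Qed.

(** Double counting of the paths [z b w] with [w != z]: by the middle vertex [b] from below, by the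
    end [w] from above. *)
Lemma max_degree_min_degree B (z : V) (d k : nat) :
  (forall x y, x != y -> #|nbhd B x :&: nbhd B y| <= k) ->
  (forall x y, B x y -> d <= #|nbhd B x|) ->
  #|nbhd B z| * d.-1 <= #|V|.-1 * k.
Proof.
move=> Bk Bd.
have -> : #|V|.-1 * k = \sum_(w in [set~ z]) k by rewrite sum_nat_const cardsC1.
apply: (@leq_trans (\sum_(b in nbhd B z) #|nbhd B b :\ z|)).
  rewrite -sum_nat_const; apply: leq_sum => b; rewrite inE => Bzb.
  have Bbz : B b z by rewrite adj_sym.
  have := Bd _ _ Bbz; rewrite (cardsD1 z) inE Bbz; lia.
have -> : \sum_(b in nbhd B z) #|nbhd B b :\ z|
          = \sum_(b in nbhd B z) \sum_(w in [set~ z]) (B b w : nat).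
  apply: eq_bigr => b _; rewrite -sum1_card big_mkcond [RHS]big_mkcond /=.
  by apply: eq_bigr => w _; rewrite !inE; case: (w != z); case: (B b w).
rewrite exchange_big /=; apply: leq_sum => w; rewrite !inE eq_sym => zw.
apply: leq_trans (Bk _ _ zw); rewrite -sum1_card big_mkcond [leqRHS]big_mkcond /=.
by apply: leq_sum => b _; rewrite !inE (adj_sym B w); case: (B z b); case: (B b w).
Qed.

Lemma near_packing_card B R u v D q :
  near_packing B R u v -> ~~ self_packs B R ->
  (forall x, #|nbhd B x| <= D) -> (forall x, #|nbhd R x| <= q) ->
  #|V|.-1 <= 2 * D * q.
Proof.
move=> near nopack BD Rq.
have sub : [set~ v] \subset nbhd2 B R u :|: nbhd2 R B u.
  by apply/subsetP=> w; rewrite in_setC1; apply: swap_blocked near nopack.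
rewrite -(cardsC1 v); apply: leq_trans (subset_leq_card sub) _.
apply: leq_trans (leq_card_setU _ _) _.
apply: leq_trans (leq_add (card_nbhd2 _ _ Rq) (card_nbhd2 _ _ BD)) _.
have := leq_mul (BD u) (leqnn q); have := leq_mul (Rq u) (leqnn D); lia.
Qed.

(* The sets [T y] below: codegrees being small, two families of blue
   neighbourhoods can only share the large set [S] through common centres, so
   each [T y] fills more than half of [nbhd R u]; but a vertex of [nbhd R u] lies
   in at most [q] of the more than [2 * q] sets [T y]. *)
Lemma near_packing_self_packs B R u v (D q t d : nat) :
  near_packing B R u v ->
  (forall x, #|nbhd B x| <= D) -> (forall x, #|nbhd R x| <= q) ->
  (forall x y, x != y -> #|nbhd B x :&: nbhd B y| <= t) ->
  #|nbhd B u| <= d -> d <= 2 * t * q + 1 ->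
  D * q + 2 * q + 1 < #|V| ->
  D * q + 2 * (3 * t * q ^ 2 + (t + 3) * q) < 2 * #|V| ->
  self_packs B R.
Proof.
move=> near BD Rq Bt Bud d_le n1 n2; have [//|nopack] := boolP (self_packs B R); exfalso.
have [Buv Ruv cuv] := near.
pose S := ~: (nbhd2 B R u :|: nbhd R u).
pose Y := ~: (v |: nbhd2 R B u).
(* Blue centres for [y]: including [y] itself absorbs the term [nbhd B y] of [rotation_blocked]. *)
pose C y := y |: nbhd R y.
pose T y := nbhd R u :&: C y.
have cardS : #|V| <= #|S| + (d * q + q).
  rewrite -(cardsC S) leq_add2l setCK (leq_trans (leq_card_setU _ _)) //.
  by rewrite leq_add // (leq_trans (card_nbhd2 _ _ Rq)) // leq_mul2r Bud orbT.
have cardY : #|V| <= #|Y| + (1 + D * q).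
  rewrite -(cardsC Y) leq_add2l setCK (leq_trans (leq_card_setU _ _)) //.
  rewrite cards1 leq_add2l (leq_trans (card_nbhd2 _ _ BD)) //.
  by rewrite mulnC leq_mul2l Rq orbT.
have cardC y : #|C y| <= q.+1.
  by rewrite /C cardsU1 -addn1 addnC leq_add ?Rq ?leq_b1.
have subS y : y \in Y -> S \subset
    ((\bigcup_(x in nbhd R u) nbhd B x) :&: (\bigcup_(x in C y) nbhd B x))
    :|: nbhd R y.
  rewrite !inE negb_or => /andP[yv yRB].
  apply/subsetP=> s; rewrite in_setC in_setU negb_or => /andP[sBR sR].
  have sv : s != v by apply: contraNneq sR => ->; rewrite inE.
  have := swap_blocked near nopack sv; rewrite inE (negPf sBR) /= => sRB.
  rewrite in_setU in_setI -/(nbhd2 R B u) sRB /=.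
  have := rotation_blocked near nopack sBR sR yRB yv.
  rewrite !in_setU => /orP[|->]; last by rewrite orbT.
  move=> h; apply/orP; left; apply/bigcupP; case/orP: h => [/nbhd2P[x Ryx Bxs]|h].
    by exists x; rewrite ?inE ?Ryx ?orbT.
  by exists y; rewrite ?in_setU1 ?eqxx.
(* Otherwise [2 * #|V|] is at most [D * q] plus twice [d * q + q] (outside [S]), [t * q * (q + 1)]
   (distinct centres) and [q] (red neighbours of [y]); with [d <= 2 * t * q + 1] this is exactly the
   bound excluded by [n2]. *)
have cardT y : y \in Y -> q < 2 * #|T y|.
  move=> Yy; have := subset_leq_card (subS y Yy).
  move=> /leq_trans/(_ (leq_card_setU _ _)) le1.
  have le2 := card_common_nbhd2 (nbhd R u) (C y) BD Bt.
  have le3 := leq_mul (leqnn t) (leq_mul (Rq u) (cardC y)).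
  have le4 := Rq y; have le5 := leq_mul d_le (leqnn q).
  rewrite -/(T y) in le2; set X := #|_ :&: _| in le1 le2.
  rewrite ltnNge; apply/negP => /(leq_mul (leqnn D)) le6.
  move: le3 le5 le6 n2; rewrite -mulnn; nia.
have sumT : \sum_(y in Y) #|T y| <= q * q.
  have -> : \sum_(y in Y) #|T y| =
            \sum_(y in Y) \sum_(x in nbhd R u) (x \in C y : nat).
    apply: eq_bigr => y _; rewrite -sum1_card big_mkcond [RHS]big_mkcond /=.
    by apply: eq_bigr => x _; rewrite in_setI; case: (x \in _); case: (x \in _).
  rewrite exchange_big /=; apply: (@leq_trans (\sum_(x in nbhd R u) q)); last first.
    by rewrite sum_nat_const leq_mul2r Rq orbT.
  apply: leq_sum => x; rewrite inE => Rux; have Rxu : R x u by rewrite adj_sym.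
  (* [x] lies in [C x] as well as in the sets of its red neighbours, but [u] is one of these and is
     not in [Y], so the count stays at [q]. *)
  have le : #|x |: (nbhd R x :\ u)| <= q.
    apply: leq_trans (leq_card_setU _ _) _.
    by rewrite cards1; have := Rq x; rewrite (cardsD1 u) inE Rxu.
  apply: leq_trans le; rewrite -sum1_card big_mkcond [leqRHS]big_mkcond /=.
  apply: leq_sum => y _; case: ifP => // Yy.
  have yu : y != u.
    apply: contraTneq Yy => ->; rewrite !inE negbK; apply/orP; right.
    by apply/nbhd2P; exists v => //; rewrite adj_sym.
  rewrite !inE yu /= eq_sym (adj_sym R y x).
  by case: eqVneq; case: (R x y).
have : \sum_(y in Y) q.+1 <= 2 * (q * q).
  apply: leq_trans (leq_mul (leqnn 2) sumT); rewrite big_distrr /=.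
  exact: leq_sum.
(* [n1] and [cardY] give [2 * q < #|Y|], while [(2 * q + 1) * (q + 1)] exceeds [2 * q ^ 2]. *)
rewrite sum_nat_const; nia.
Qed.

(** * Induction on the number of blue edges *)

Lemma del_edge_sym G u v :
  symmetric (fun x y => G x y && ([set x; y] != [set u; v])).
Proof. by move=> x y; rewrite adj_sym setUC. Qed.

Lemma del_edge_irrefl G u v :
  irreflexive (fun x y => G x y && ([set x; y] != [set u; v])).
Proof. by move=> x; rewrite adj_irrefl. Qed.

Definition del_edge G u v := SGraph (del_edge_sym G u v) (del_edge_irrefl G u v).

Lemma nbhd_del_edge G u v x : nbhd (del_edge G u v) x \subset nbhd G x.
Proof. by apply/subsetP=> y; rewrite !inE => /andP[]. Qed.

End Conflicts.

Lemma pullback_sym (V W : finType) (f : V -> W) (G : sgraph W) :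
  symmetric (fun x y => G (f x) (f y)).
Proof. by move=> x y; rewrite adj_sym. Qed.

Lemma pullback_irrefl (V W : finType) (f : V -> W) (G : sgraph W) :
  irreflexive (fun x y => G (f x) (f y)).
Proof. by move=> x; rewrite adj_irrefl. Qed.

(** Carries the red graph to the blue vertex set along a placement, so that a better placement
    becomes a permutation. *)
Definition pullback (V W : finType) (f : V -> W) (G : sgraph W) :=
  SGraph (pullback_sym f G) (pullback_irrefl f G).

Lemma card_nbhd_pullback (V W : finType) (f : V -> W) (G : sgraph W) x :
  injective f -> #|nbhd (pullback f G) x| <= #|nbhd G (f x)|.
Proof.
move=> f_inj; rewrite -(card_imset _ f_inj); apply/subset_leq_card/subsetP=> z.
by case/imsetP=> y; rewrite !inE => Gxy ->.
Qed.

Lemma bounded_codegree_packing (V W : finType) (B : sgraph V) (R : sgraph W)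
    (D q t : nat) :
  #|V| = #|W| ->
  (forall x, #|nbhd B x| <= D) -> (forall x, #|nbhd R x| <= q) ->
  (forall x y, x != y -> #|nbhd B x :&: nbhd B y| <= t) ->
  D * q + 2 * q + 1 < #|V| ->
  D * q + 2 * (3 * t * q ^ 2 + (t + 3) * q) < 2 * #|V| ->
  exists2 f : V -> W, injective f & forall x y, B x y -> ~~ R (f x) (f y).
Proof.
move=> VW BD Rq Bt n1 n2.
have [m] := ubnP #|[set p : V * V | B p.1 p.2]|.
elim: m B BD Bt => // m IHm B BD Bt; rewrite ltnS => leBm.
have [B0|[u0 Bu0]] : (forall x y, ~~ B x y) \/ exists x, 0 < #|nbhd B x|.
  have [/existsP ex|] := boolP [exists x, 0 < #|nbhd B x|]; first by right.
  rewrite negb_exists => /forallP no; left=> x y; apply/negP => Bxy.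
  have := no x; rewrite -eqn0Ngt cards_eq0 => /eqP/setP/(_ y).
  by rewrite !inE Bxy.
  exists (fun x => enum_val (cast_ord VW (enum_rank x))) => [|x y Bxy].
    by move=> x y /enum_val_inj/cast_ord_inj/enum_rank_inj.
  by have := B0 x y; rewrite Bxy.
case: (@arg_minnP _ u0 (fun x => 0 < #|nbhd B x|) (fun x => #|nbhd B x|) Bu0).
move=> u /card_gt0P[v]; rewrite inE => Buv min_u.
case: (@arg_maxnP _ u0 predT (fun x => #|nbhd B x|) isT) => z _ max_z.
have sub := nbhd_del_edge B u v.
have [|||f f_inj fP] := IHm (del_edge B u v).
- by move=> x; apply: leq_trans (BD x); apply: subset_leq_card.
- by move=> x y /Bt; apply: leq_trans; apply/subset_leq_card/setISS.
- apply: leq_trans leBm; apply: proper_card; apply/properP; split.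
    by apply/subsetP=> p; rewrite !inE => /andP[].
  by exists (u, v); rewrite !inE //= eqxx andbF.
(* If the deleted edge lands on a red non-edge, [f] already works; otherwise [uv] is the only
   conflict. *)
have [Rfuv|nRfuv] := boolP (R (f u) (f v)); last first.
  exists f => // x y Bxy; have [e|ne] := eqVneq [set x; y] [set u; v]; last first.
    by apply: fP; rewrite /= Bxy.
  have xy : x != y by apply: contraTneq Bxy => ->; rewrite adj_irrefl.
  have := set21 x y; have := set22 x y; rewrite e !inE.
  case/orP=> /eqP ey; case/orP=> /eqP ex; subst x y => //.
  - by rewrite eqxx in xy.
  - by rewrite adj_sym.
  - by rewrite eqxx in xy.
pose R' := pullback f R.
have R'q x : #|nbhd R' x| <= q.
  exact: leq_trans (card_nbhd_pullback _ _ f_inj) (Rq _).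
have near : near_packing B R' u v.
  split=> // x y Bxy Rxy; apply/eqP; apply: contraTT Rxy => ne.
  by apply: fP; rewrite /= Bxy.
have packed : self_packs B R'.
  have [//|nopack] := boolP (self_packs B R'); exfalso.
  (* The attained maximum degree [D'], rather than the bound [D], stands on both sides of [le3] and
     cancels, leaving [d.-1 <= 2 * t * q]. *)
  set D' := #|nbhd B z| in max_z; set d := #|nbhd B u| in min_u.
  have BD' x : #|nbhd B x| <= D' by apply: max_z.
  have le1 := near_packing_card near nopack BD' R'q.
  have le2 : D' * d.-1 <= #|V|.-1 * t.
    apply: max_degree_min_degree => // x y Bxy; apply: min_u.
    by apply/card_gt0P; exists y; rewrite inE.
  have D'_gt0 : 0 < D' by apply: leq_trans (BD' u0).
  have le3 : D' * d.-1 <= D' * (2 * t * q).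
    by apply: leq_trans le2 _; apply: leq_trans (leq_mul le1 (leqnn t)) _; nia.
  rewrite leq_pmul2l // in le3.
  case/negP: nopack; apply: (near_packing_self_packs (d := d) near BD R'q Bt) => //.
  lia.
case/existsP: packed => p /forallP pP; exists (f \o p) => [|x y Bxy].
  exact: inj_comp f_inj perm_inj.
by have /forallP/(_ y)/implyP/(_ Bxy) := pP x.
Qed.

(** * Placements as packings, and the numerical bounds on [n] *)

Lemma pack_of_placement (n : nat) (V1 V2 : finType) (G1 : sgraph V1)
    (G2 : sgraph V2) (f : V1 -> V2) :
  #|V2| = n -> injective f ->
  (forall x y, G1 x y -> ~~ G2 (f x) (f y)) -> pack n G1 G2.
Proof.
move=> V2n f_inj fP; pose g x := cast_ord V2n (enum_rank x).
have g_inj : injective g by move=> x y /cast_ord_inj/enum_rank_inj.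
exists (g \o f), g; split=> //; first exact: inj_comp.
rewrite disjoint_subset; apply/subsetP=> e /imsetP[e1 /imsetP[[x y]]].
rewrite inE /= => G1xy -> ->; apply/imsetP=> -[e2 /imsetP[[a b]]].
rewrite inE /= => G2ab -> /eqP; rewrite imset_comp (inj_eq (imset_inj g_inj)).
rewrite imsetU1 imset_set1 => /eqP eab.
have ab : a != b by apply: contraTneq G2ab => ->; rewrite adj_irrefl.
have := fP _ _ G1xy; have := set21 a b; have := set22 a b.
rewrite -eab !inE => /orP[]/eqP eb /orP[]/eqP ea; subst a b.
- by rewrite eqxx in ab.
- by rewrite adj_sym G2ab.
- by rewrite G2ab.
- by rewrite eqxx in ab.
Qed.

Local Open Scope ring_scope.

(** Yields [1 < alpha], which turns the second bound on [n] into one free of [alpha]. *)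
Lemma alpha_star_ge1 (R : realType) (t D2 : nat) :
  (0 < t)%N -> 1 <= alpha_star R t D2.
Proof.
move=> t_gt0; rewrite /alpha_star; set g := pack_gamma R t D2.
have g_ge0 : 0 <= g.
  rewrite /g /pack_gamma !mulr_ge0 ?invr_ge0 ?ler0n ?subr_ge0 ?ler1n //.
  by rewrite addr_ge0 ?ler0n.
have := sqrtr_ge0 (4 * g + g ^+ 2); lra.
Qed.

Theorem theorem1 (R : realType) (n : nat) (V1 V2 : finType)
  (G1 : sgraph V1) (G2 : sgraph V2)
  (hV1 : #|V1| = n) (hV2 : #|V2| = n)
  (D1 D2 : nat)
  (hD1 : max_degree G1 = D1) (hD2 : max_degree G2 = D2)
  (D2_ge1 : (1 <= D2)%N)
  (t : nat) (t_ge2 : (2 <= t)%N)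
  (alpha eps : R)
  (halpha : alpha_star R t D2 < alpha)
  (heps : 0 < eps < 1 / 2)
  (* the first bound below is meaningful only for a nonzero denominator *)
  (hden : (alpha - 1) ^+ 2 - alpha != 0)
  (hcodeg : (max_codegree G1 < t)%N)
  (hn1 : (t%:R + alpha * (alpha - 1) / ((alpha - 1) ^+ 2 - alpha)) * D2%:R
         + D1%:R * D2%:R < n%:R)
  (hn2 : (2 * alpha * t%:R + 2) * D2%:R
         + ((2 * alpha + 1) * t%:R - 1) * D2%:R ^+ 2
         + (1 - eps) * (D1%:R * D2%:R) < n%:R)
  (hn3 : 1 + (2 + eps / (1 - 2 * eps)) * D2%:R + D1%:R * D2%:R < n%:R)
  (hn4 : (t%:R + (3 - eps) / 2) * D2%:R
         + (3 - eps) / 2 * (t%:R - 1) * D2%:R ^+ 2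
         + (1 + eps) / 2 * (D1%:R * D2%:R) < n%:R) :
  pack n G1 G2.
Proof.
have [e_gt0 e_lt] := andP heps.
have a_gt1 : 1 < alpha.
  by apply: le_lt_trans halpha; apply: alpha_star_ge1; apply: ltnW.
have dx : 0 <= D1%:R * D2%:R :> R by rewrite mulr_ge0 ?ler0n.
have qx : 0 <= D2%:R :> R by rewrite ler0n.
have q2x : 0 <= D2%:R ^+ 2 :> R by rewrite exprn_ge0.
have tx : 2 <= t%:R :> R by rewrite ler_nat.
(* From the third bound, as [eps / (1 - 2 * eps)] is nonnegative. *)
have n1 : (D1 * D2 + 2 * D2 + 1 < n)%N.
  rewrite -(ltr_nat R) !natrD !natrM; apply: le_lt_trans hn3.
  have : 0 <= eps / (1 - 2 * eps) * D2%:R.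
    by rewrite mulr_ge0 // divr_ge0 //; lra.
  lra.
(* Twice the second bound, with [alpha] lowered to 1 and [eps] raised to 1/2; the codegree bound is
   [t.-1]. *)
have n2 : (D1 * D2 + 2 * (3 * t.-1 * D2 ^ 2 + (t.-1 + 3) * D2) < 2 * n)%N.
  have tE : (t.-1)%:R = t%:R - 1 :> R by rewrite -subn1 natrB // ltnW.
  rewrite -(ltr_nat R) !(natrX, natrM, natrD) tE.
  have h1 : 0 <= (alpha - 1) * t%:R * D2%:R by rewrite !mulr_ge0 //; lra.
  have h2 : 0 <= (alpha - 1) * t%:R * D2%:R ^+ 2 by rewrite !mulr_ge0 //; lra.
  have h3 : 0 <= (1 / 2 - eps) * (D1%:R * D2%:R) by rewrite mulr_ge0 //; lra.
  have h4 : 0 <= t%:R * D2%:R :> R by rewrite mulr_ge0 ?ler0n.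
  have := hn2; lra.
have [||||||f f_inj fP] :=
    @bounded_codegree_packing V1 V2 G1 G2 D1 D2 t.-1; rewrite ?hV1 ?hV2 //.
- by move=> x; rewrite -hD1; apply: leq_bigmax.
- by move=> x; rewrite -hD2; apply: leq_bigmax.
- move=> x y xy; rewrite -ltnS prednK; last exact: ltnW.
  apply: leq_ltn_trans hcodeg.
  exact: (@leq_bigmax_cond _ (fun p : V1 * V1 => p.1 != p.2)
    (fun p => #|nbhd G1 p.1 :&: nbhd G1 p.2|) (x, y)).
exact: pack_of_placement hV2 f_inj fP.
Qed.
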